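(* An operation $j\colon\Omega\to\Omega$ is monotone if and only if $\mathsf{cl}_j$ is a universal monotone operator.
   Context: Let $(\mathsf N,\mathbf N,\ast)$ be one of: (i) Kleene's first algebra: $\mathsf N=\mathbf N=\mathbb N$, $e\ast n=\varphi_e(n)$ for the standard indexing of partial computable functions on $\mathbb N$; (ii) Kleene's second algebra: $\mathsf N=\mathbf N=\mathbb N^{\mathbb N}$, $x\ast y=\varphi_x(y)$ for the standard indexing $(\varphi_x)_{x\in\mathbb N^{\mathbb N}}$ of partial continuous functions on Baire space (e.g. $(x\ast y)(n)=x(\langle n,y(0),\dots,y(k-1)\rangle)-1$ for the least $k$ making $x(\cdots)>0$; $x\ast y$ is defined iff such $k$ exists for all $n$); (iii) the Kleene–Vesley algebra: $\mathbf N=\mathbb N^{\mathbb N}$ with $\ast$ as in (ii) and $\mathsf N$ the set of computable elements of $\mathbb N^{\mathbb N}$. $\langle\cdot,\cdot\rangle$ is a standard computable pairing on $\mathbf N$. $\Omega=\mathcal P(\mathbf N)$. For $p,q\in\Omega$, $p\wedge q=\{\langle a,b\rangle:a\in p,\,b\in q\}$ and $p\to q=\{x\in\mathbf N: x\ast a\text{ is defined and }x\ast a\in q\text{ for all }a\in p\}$. An operation $j\colon\Omega\to\Omega$ is monotone if some $e\in\mathsf N$ belongs to $(p\to q)\to(j(p)\to j(q))$ for all $p,q\in\Omega$. An assembly (equivalently, a multi-represented space) is a set $X$ with a function $E_X\colon X\to\Omega\setminus\{\emptyset\}$; elements of $E_X(x)$ are names of $x$. A map $f\colon X\to Y$ is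 computable if some $e\in\mathsf N$ belongs to $E_X(x)\to E_Y(f(x))$ for all $x\in X$. A subobject $A$ of $X$ is represented by an assembly whose underlying set is a subset $A\subseteq X$ and whose inclusion map $A\to X$ is computable. For subobjects $A,B$ of $X$, $A\leq B$ means $A\subseteq B$ as sets and the inclusion $A\to B$ is computable; $A\equiv B$ means $A\leq B$ and $B\leq A$. $\mathsf{Sub}(X)$ is the collection of subobjects of $X$ (up to $\equiv$), ordered by $\leq$. For a subobject $A$ of $X$ and $x\in X$ let $\hat E_A(x)=E_A(x)$ if $x\in A$ and $\hat E_A(x)=\emptyset$ if $x\in X\setminus A$. The $j$-closure $\mathsf{cl}_j(A)$ of $A$ is the subobject of $X$ with $E_{\mathsf{cl}_j(A)}(x)=j(\hat E_A(x))\wedge E_X(x)$ and underlying set $\{x\in X:E_{\mathsf{cl}_j(A)}(x)\neq\emptyset\}$. For a computable map $f\colon Y\to X$ and a subobject $A$ of $X$, $f^\ast A$ is the subobject of $Y$ with underlying set $\{y\in Y:f(y)\in A\}$ and $E_{f^\ast A}(y)=E_Y(y)\wedge E_A(f(y))$. A universal monotone operator is an assignment $c$, giving for each assembly $X$ a map $c_X\colon\mathsf{Sub}(X)\to\mathsf{Sub}(X)$, such that (monotone) for all $X$ and subobjects $A,B$ of $X$, $A\leq B$ implies $c_X(A)\leq c_X(B)$; and (natural) $c_Y(f^\ast A)\equiv f^\ast(c_X(A))$ for every computable $f\colon Y\to X$ and every subobject $A$ of $X$. *)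

(* Defs.v *)
From Stdlib Require Cantor.
From mathcomp Require Import all_boot.
From mathcomp Require Import boolp classical_sets.

Set Implicit Arguments.
Unset Strict Implicit.
Unset Printing Implicit Defensive.

Local Open Scope classical_set_scope.

(* Partial computable functions on nat: Kleene's partial recursive functions,
   in unary form, arguments being packed with the Cantor pairing function. *)

Definition npair (a b : nat) : nat := Cantor.to_nat (a, b).
Definition nfst (n : nat) : nat := (Cantor.of_nat n).1.
Definition nsnd (n : nat) : nat := (Cantor.of_nat n).2.

Inductive code : Type :=
| Zero
| Succ
| Fst
| Snd
| Pair of code & code
| Comp of code & code
| Prec of code & code
| Mu of code.

Fixpoint prec_graph (F G : nat -> set nat) (a n : nat) : set nat :=
  if n is n'.+1 then
    [set m | exists2 k, prec_graph F G a n' k & G (npair a (npair n' k)) m]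
  else F a.

(* [eval c n m] is the graph of the partial function computed by [c].
   [Prec f g] is h(<a, 0>) = f(a), h(<a, n + 1>) = g(<a, <n, h(<a, n>)>>), and
   [Mu f] sends a to the least m such that f(<a, m>) = 0, with f(<a, i>)
   defined for every i < m. *)
Fixpoint eval (c : code) : nat -> set nat :=
  match c with
  | Zero => fun _ => [set 0]
  | Succ => fun n => [set n.+1]
  | Fst => fun n => [set nfst n]
  | Snd => fun n => [set nsnd n]
  | Pair f g => fun n => [set npair a b | a in eval f n & b in eval g n]
  | Comp f g => fun n => [set m | exists2 k, eval g n k & eval f k m]
  | Prec f g => fun n => prec_graph (eval f) (eval g) (nfst n) (nsnd n)
  | Mu f => fun n => [set m | eval f (npair n m) 0 /\
              forall i, i < m -> exists k, eval f (npair n i) k.+1]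
  end.

Fixpoint goedel (c : code) : nat :=
  match c with
  | Zero => npair 0 0
  | Succ => npair 1 0
  | Fst => npair 2 0
  | Snd => npair 3 0
  | Pair f g => npair 4 (npair (goedel f) (goedel g))
  | Comp f g => npair 5 (npair (goedel f) (goedel g))
  | Prec f g => npair 6 (npair (goedel f) (goedel g))
  | Mu f => npair 7 (goedel f)
  end.

(* [phi e n m] means that phi_e(n) is defined and equal to m; a number [e]
   that is not a Goedel number is an index of the empty function. *)
Definition phi (e n : nat) : set nat :=
  [set m | exists2 c, goedel c = e & eval c n m].

Lemma npair_inj (a b a' b' : nat) :
  npair a b = npair a' b' -> a = a' /\ b = b'.
Proof. by move=> /Cantor.to_nat_inj[]. Qed.

Lemma goedel_inj : injective goedel.
Proof.
elim=> [||||f IHf g IHg|f IHf g IHg|f IHf g IHg|f IHf]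
       [||||f' g'|f' g'|f' g'|f'] //= /npair_inj[] //.
- by move=> _ /npair_inj[/IHf-> /IHg->].
- by move=> _ /npair_inj[/IHf-> /IHg->].
- by move=> _ /npair_inj[/IHf-> /IHg->].
- by move=> _ /IHf->.
Qed.

Lemma eval_fun (c : code) (n m m' : nat) : eval c n m -> eval c n m' -> m = m'.
Proof.
elim: c n m m' => [||||f IHf g IHg|f IHf g IHg|f IHf g IHg|f IHf] n m m' /=.
- by move=> -> ->.
- by move=> -> ->.
- by move=> -> ->.
- by move=> -> ->.
- move=> [a fa [b gb <-]] [a' fa' [b' gb' <-]].
  by rewrite (IHf _ _ _ fa fa') (IHg _ _ _ gb gb').
- move=> [k gk fk] [k' gk']; rewrite -(IHg _ _ _ gk gk'); exact: IHf.
- elim: (nsnd n) m m' => [|i IHi] m m' /=; first exact: IHf.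
  move=> [k hk gk] [k' hk']; rewrite -(IHi _ _ hk hk'); exact: IHg.
- move=> [fm lm] [fm' lm']; case: (ltngtP m m') => // [/lm'|/lm] [k fk].
  + by have := IHf _ _ _ fm fk.
  + by have := IHf _ _ _ fm' fk.
Qed.

Lemma phi_fun (e n m m' : nat) : phi e n m -> phi e n m' -> m = m'.
Proof.
move=> [c <- cm] [c' /goedel_inj->]; exact: eval_fun.
Qed.

(* Partial continuous functions on Baire space. *)

Definition baire : Type := nat -> nat.

Fixpoint tuple_code (s : seq nat) : nat :=
  if s is a :: s' then (npair a (tuple_code s')).+1 else 0.

(* [bapp x y z] means that x * y is defined and equal to z. *)
Definition bapp (x y : baire) : set baire :=
  [set z | forall n, exists2 k : nat,
     x (tuple_code (n :: mkseq y k)) = (z n).+1 &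
     forall i, i < k -> x (tuple_code (n :: mkseq y i)) = 0].

Lemma bapp_fun (x y z z' : baire) : bapp x y z -> bapp x y z' -> z = z'.
Proof.
move=> xyz xyz'; apply: funext => n.
have [k xk lk] := xyz n; have [k' xk' lk'] := xyz' n.
case: (ltngtP k k') => [/lk'|/lk|kk'].
- by rewrite xk.
- by rewrite xk'.
- by move: xk; rewrite kk' xk' => -[].
Qed.

Definition bpair (x y : baire) : baire :=
  fun n => if odd n then y n./2 else x n./2.

Definition computable_baire : set baire :=
  [set x | exists e, forall n, phi e n (x n)].

(* [el] is the set of all elements and [eff] the subset of effective ones, the
   only ones allowed as realizers; [app x y z] means that x * y is defined and
   equal to z. *)
Record algebra : Type := Algebra {
  el :> Type;
  eff : set el;
  app : el -> el -> set el;
  app_fun : forall x y z z', app x y z -> app x y z' -> z = z';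
  pr : el -> el -> el }.

Definition kleene_first : algebra := @Algebra nat setT phi phi_fun npair.
Definition kleene_second : algebra := @Algebra baire setT bapp bapp_fun bpair.
Definition kleene_vesley : algebra :=
  @Algebra baire computable_baire bapp bapp_fun bpair.

Section Realizability.
Variable N : algebra.

Definition Omega : Type := set N.

Definition wedge (p q : Omega) : Omega := [set pr a b | a in p & b in q].

Definition arrow (p q : Omega) : Omega :=
  [set x | forall a, p a -> exists2 b, app x a b & q b].

Definition monotone_operation (j : Omega -> Omega) : Prop :=
  exists2 e, eff e & forall p q, arrow (arrow p q) (arrow (j p) (j q)) e.

Record assembly : Type := Assembly {
  carrier :> Type;
  names : carrier -> Omega;
  names_neq0 : forall x, names x !=set0 }.

Definition computable (X Y : assembly) (f : X -> Y) : Prop :=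
  exists2 e, eff e & forall x, arrow (names x) (names (f x)) e.

Record subassembly (X : assembly) : Type := Subassembly {
  support : set X;
  sub_names : {x : X | support x} -> Omega;
  sub_names_neq0 : forall u, sub_names u !=set0 }.

Definition assembly_of (X : assembly) (A : subassembly X) : assembly :=
  Assembly (@sub_names_neq0 X A).

Definition is_subobject (X : assembly) (A : subassembly X) : Prop :=
  @computable (assembly_of A) X (fun u => sval u).

Definition inclusion (X : assembly) (A B : subassembly X)
    (AB : support A `<=` support B) : assembly_of A -> assembly_of B :=
  fun u => exist _ (sval u) (AB _ (svalP u)).

Definition sub_le (X : assembly) (A B : subassembly X) : Prop :=
  exists AB : support A `<=` support B, computable (inclusion AB).

Definition sub_equiv (X : assembly) (A B : subassembly X) : Prop :=
  sub_le A B /\ sub_le B A.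

Definition hat_names (X : assembly) (A : subassembly X) (x : X) : Omega :=
  match pselect (support A x) with
  | left Ax => sub_names (exist _ x Ax)
  | right _ => set0
  end.

Definition closure_names (j : Omega -> Omega) (X : assembly)
    (A : subassembly X) (x : X) : Omega :=
  wedge (j (hat_names A x)) (names x).

Definition cl (j : Omega -> Omega) (X : assembly) (A : subassembly X) :
    subassembly X :=
  @Subassembly X [set x | closure_names j A x !=set0]
    (fun u => closure_names j A (sval u)) (fun u => svalP u).

Lemma wedge_neq0 (p q : Omega) : p !=set0 -> q !=set0 -> wedge p q !=set0.
Proof. by move=> [a pa] [b qb]; exists (pr a b); exists a => //; exists b. Qed.

Definition pullback (X Y : assembly) (f : Y -> X) (A : subassembly X) :
    subassembly Y :=
  @Subassembly Y [set y | support A (f y)]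
    (fun u => wedge (names (sval u)) (sub_names (exist _ (f (sval u)) (svalP u))))
    (fun u => wedge_neq0 (names_neq0 (sval u)) (sub_names_neq0 _)).

(* An operator acts on representatives of subobjects rather than on classes
   modulo [sub_equiv]: its monotonicity clause makes it well defined on
   classes, and [cl j] need not be so for an arbitrary [j]. Its values
   outside subobjects are irrelevant. *)
Record universal_monotone_operator
    (c : forall X : assembly, subassembly X -> subassembly X) : Prop :=
  UniversalMonotoneOperator {
  umo_subobject : forall (X : assembly) (A : subassembly X),
    is_subobject A -> is_subobject (c X A);
  umo_monotone : forall (X : assembly) (A B : subassembly X),
    is_subobject A -> is_subobject B -> sub_le A B -> sub_le (c X A) (c X B);
  umo_natural : forall (X Y : assembly) (f : Y -> X) (A : subassembly X),
    computable f -> is_subobject A ->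
    sub_equiv (c Y (pullback f A)) (pullback f (c X A)) }.

End Realizability.

Arguments cl {N} j X A.

(* Main.v *)
Require Import Defs.
From Stdlib Require Cantor.
From mathcomp Require Import all_boot.
From mathcomp Require Import boolp classical_sets.

(* The order on subobjects of X is the realizability entailment between the
   families x |-> hat E_A(x), and both implications are derivations in the logic
   of this entailment. If j is monotone, naturality of cl_j follows by applying
   j to the entailments E_Y(y) /\ p |- p and, with E_Y(y) as a context,
   p |- E_Y(y) /\ p. Conversely, let Y be the assembly of the pairs (p, q) such
   that p -> q is nonempty, with names p -> q. The pullbacks to Y of the generic
   subobject {p | p nonempty} of Omega along both projections have names
   (p -> q) /\ p and (p -> q) /\ q, and evaluation shows that the first is below
   the second; applying cl_j, naturality gives
   (p -> q) /\ j(p) |- (p -> q) /\ j(q) over Y, and currying is monotonicity.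

   The logic only needs projections, constants, pairing, application and currying
   to be effective. For the first algebra, application is a universal function.
   For Baire space, all associates are built by primitive recursive operations,
   which covers the second algebra and the Kleene-Vesley algebra at once. *)

Set Implicit Arguments.
Unset Strict Implicit.
Unset Printing Implicit Defensive.

Local Open Scope classical_set_scope.

(** * Realizability entailment *)

(** The last three laws constrain a realizer only where the given applications are defined, so it
    may be defined on more. In [realize_curry], [h] depends on an arbitrary [a] and is not claimed
    effective, but it exists for every [a]. *)
Record combinatory (N : algebra) : Prop := Combinatory {
  realize_fst : exists2 e : N, eff e & forall a b, app e (pr a b) a;
  realize_snd : exists2 e : N, eff e & forall a b, app e (pr a b) b;
  realize_const : forall c : N, eff c ->
    exists2 e : N, eff e & forall a, app e a c;
  realize_pair : forall f g : N, eff f -> eff g ->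
    exists2 e : N, eff e &
      forall a b c, app f a b -> app g a c -> app e a (pr b c);
  realize_app : forall f g : N, eff f -> eff g ->
    exists2 e : N, eff e &
      forall a b c d, app f a b -> app g a c -> app b c d -> app e a d;
  realize_curry : forall f : N, eff f ->
    exists2 e : N, eff e &
      forall a, exists2 h, app e a h &
        forall b c, app f (pr a b) c -> app h b c }.

Section Logic.
Variable N : algebra.
Hypothesis HN : combinatory N.

Definition entails (I : Type) (p q : I -> Omega N) : Prop :=
  exists2 e, eff e & forall i, arrow (p i) (q i) e.

Section Rules.
Variable I : Type.
Implicit Types p q r : I -> Omega N.

Lemma entails_const r p (e : N) : eff e -> (forall i, p i e) -> entails r p.
Proof.
move=> ee pe; have [k ek ke] := realize_const HN ee.
by exists k => // i a _; exists e.
Qed.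

Lemma entails_mp r p q :
  entails r (fun i => arrow (p i) (q i)) -> entails r p -> entails r q.
Proof.
move=> [f ef fP] [g eg gP]; have [e ee eP] := realize_app HN ef eg.
exists e => // i a ra.
have [b fb pqb] := fP i a ra; have [c gc pc] := gP i a ra.
by have [d bd qd] := pqb c pc; exists d => //; exact: eP fb gc bd.
Qed.

Lemma entails_trans q p r : entails p q -> entails q r -> entails p r.
Proof.
move=> pq [e ee eP]; apply: entails_mp pq.
exact: entails_const ee eP.
Qed.

Lemma entails_fst p q : entails (fun i => wedge (p i) (q i)) p.
Proof.
by have [e ee eP] := realize_fst HN; exists e => // i _ [a pa [b qb <-]]; exists a.
Qed.

Lemma entails_snd p q : entails (fun i => wedge (p i) (q i)) q.
Proof.
by have [e ee eP] := realize_snd HN; exists e => // i _ [a pa [b qb <-]]; exists b.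
Qed.

Lemma entails_wedge r p q :
  entails r p -> entails r q -> entails r (fun i => wedge (p i) (q i)).
Proof.
move=> [f ef fP] [g eg gP]; have [e ee eP] := realize_pair HN ef eg.
exists e => // i a ra; have [b fb pb] := fP i a ra; have [c gc qc] := gP i a ra.
by exists (pr b c); [exact: eP | exists b => //; exists c].
Qed.

Lemma entails_curry r p q :
  entails (fun i => wedge (r i) (p i)) q ->
  entails r (fun i => arrow (p i) (q i)).
Proof.
move=> [f ef fP]; have [e ee eP] := realize_curry HN ef.
exists e => // i a ra; have [h eh hP] := eP a; exists h => // b pb.
have [|c fc qc] := fP i (pr a b); first by exists a => //; exists b.
by exists c => //; exact: hP.
Qed.

End Rules.

Section Hats.
Variable X : assembly N.
Implicit Types A B : subassembly X.

Lemma hat_namesE A x (Ax : Defs.support A x) :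
  hat_names A x = sub_names (exist _ x Ax).
Proof.
rewrite /hat_names; case: pselect => // Ax'.
by rewrite (Prop_irrelevance Ax' Ax).
Qed.

Lemma hat_names_out A x : ~ Defs.support A x -> hat_names A x = set0.
Proof. by rewrite /hat_names; case: pselect. Qed.

Lemma hat_names_support A x a : hat_names A x a -> Defs.support A x.
Proof. by rewrite /hat_names; case: pselect. Qed.

Lemma hat_names_sval A (u : {x | Defs.support A x}) :
  hat_names A (sval u) = sub_names u.
Proof. by case: u => x Ax; exact: hat_namesE. Qed.

(** Inclusion of supports comes from the realizer: elements of [A] have names, and outside the
    support of [B] there is no name to send them to. *)
Lemma sub_leP A B : sub_le A B <-> entails (hat_names A) (hat_names B).
Proof.
split=> [[AB [e ee eP]]|[e ee eP]].
  exists e => // x a /[dup] /hat_names_support Ax.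
  rewrite hat_namesE.
  rewrite -[hat_names B x]/(hat_names B (sval (inclusion AB (exist _ x Ax)))).
  rewrite hat_names_sval; exact: eP.
have AB : Defs.support A `<=` Defs.support B.
  move=> x Ax; have [a aA] := sub_names_neq0 (exist _ x Ax).
  have [|b _ /hat_names_support//] := eP x a.
  by rewrite hat_namesE.
exists AB; exists e => // u a uA.
have [|b ab bB] := eP (sval u) a; first by rewrite hat_names_sval.
exists b => //; move: bB.
by rewrite -[sval u]/(sval (inclusion AB u)) hat_names_sval.
Qed.

Lemma is_subobjectP A : is_subobject A <-> entails (hat_names A) (@names N X).
Proof.
split=> [[e ee eP]|[e ee eP]]; exists e => //.
  by move=> x a /[dup] /hat_names_support Ax; rewrite hat_namesE; exact: eP.
by move=> u a uA; apply: eP; rewrite hat_names_sval.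
Qed.

Lemma hat_names_cl j A : hat_names (cl j X A) = closure_names j A.
Proof.
apply: funext => x; have [xA|xA] := pselect (Defs.support (cl j X A) x).
  exact: hat_namesE xA.
rewrite hat_names_out//; apply/esym/seteqP; split=> // a xa.
by apply: xA; exists a.
Qed.

End Hats.

Lemma hat_names_pullback (X Y : assembly N) (f : Y -> X) (A : subassembly X) :
  hat_names (pullback f A) = fun y => wedge (names y) (hat_names A (f y)).
Proof.
apply: funext => y; have [yA|yA] := pselect (Defs.support (pullback f A) y).
  by rewrite (hat_namesE yA) (@hat_namesE _ A (f y) (svalP (exist _ y yA))).
rewrite hat_names_out// (@hat_names_out _ A)//.
by apply/esym/seteqP; split=> // a [b _ []].
Qed.

(** * From monotone operations to universal monotone operators *)

Section Forward.
Variable j : Omega N -> Omega N.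
Hypothesis jmon : monotone_operation j.

(** The realizer of monotonicity acts on any realizer of the implication, even one computed from the
    context [r]. *)
Lemma entails_monotone (I : Type) (r p q : I -> Omega N) :
  entails r (fun i => arrow (p i) (q i)) ->
  entails r (fun i => arrow (j (p i)) (j (q i))).
Proof.
have [e ee eP] := jmon; apply: entails_mp.
by apply: entails_const ee _ => i; exact: eP.
Qed.

Lemma entails_map (I : Type) (r p q : I -> Omega N) : entails p q ->
  entails r (fun i => arrow (j (p i)) (j (q i))).
Proof.
move=> [e ee eP]; apply: entails_monotone; exact: entails_const ee eP.
Qed.

Lemma cl_universal : universal_monotone_operator (cl j).
Proof.
split.
- move=> X A _; apply/is_subobjectP; rewrite hat_names_cl; exact: entails_snd.
- move=> X A B _ _ /sub_leP AB; apply/sub_leP; rewrite !hat_names_cl.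
  apply: entails_wedge; last exact: entails_snd.
  by apply: entails_mp (entails_fst _ _); exact: entails_map.
- move=> X Y f A fc _; split; apply/sub_leP.
    rewrite hat_names_pullback !hat_names_cl /closure_names hat_names_pullback.
    apply: entails_wedge; first exact: entails_snd.
    apply: entails_wedge; last exact: entails_trans (entails_snd _ _) fc.
    apply: entails_mp (entails_fst _ _); apply: entails_map.
    exact: entails_snd.
  rewrite hat_names_pullback !hat_names_cl /closure_names hat_names_pullback.
  apply: entails_wedge; last exact: entails_fst.
  apply: entails_mp (entails_trans (entails_snd _ _) (entails_fst _ _)).
  apply: entails_monotone; apply: entails_trans (entails_fst _ _) _.
  apply: entails_curry; apply: entails_wedge; first exact: entails_fst.
  exact: entails_snd.
Qed.

End Forward.

(** * From universal monotone operators to monotone operations *)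

Lemma effective_neq0 : exists e : N, eff e.
Proof. by have [e ee _] := realize_fst HN; exists e. Qed.

Lemma setT_neq0 : [set: N] !=set0.
Proof. by have [e _] := effective_neq0; exists e. Qed.

(* The names of the generic assembly carry no information, so that the pullback
   of the generic subobject along [f : Y -> Omega] has names [E_Y(y) /\ f(y)]. *)
Definition generic_assembly : assembly N :=
  @Assembly N (Omega N) (fun=> setT) (fun=> setT_neq0).

Definition generic_subobject : subassembly generic_assembly :=
  @Subassembly N generic_assembly [set p : Omega N | p !=set0]
    (fun u => sval u) (fun u => svalP u).

Definition arrow_assembly : assembly N :=
  @Assembly N {pq : Omega N * Omega N | arrow pq.1 pq.2 !=set0}
    (fun u => arrow (sval u).1 (sval u).2) (fun u => svalP u).

Lemma hat_names_generic (p : Omega N) : hat_names generic_subobject p = p.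
Proof.
have [p0|p0] := pselect (Defs.support generic_subobject p).
  by rewrite (hat_namesE p0).
rewrite hat_names_out//; apply/esym/seteqP; split=> // a pa.
by apply: p0; exists a.
Qed.

Lemma entails_setT (I : Type) (p : I -> Omega N) : entails p (fun=> setT).
Proof. by have [e ee] := effective_neq0; exact: entails_const ee _. Qed.

Lemma universal_monotone (j : Omega N -> Omega N) :
  universal_monotone_operator (cl j) -> monotone_operation j.
Proof.
move=> [_ jmon jnat].
pose r (u : arrow_assembly) := arrow (sval u).1 (sval u).2.
pose src (u : arrow_assembly) : generic_assembly := (sval u).1.
pose tgt (u : arrow_assembly) : generic_assembly := (sval u).2.
have subG : is_subobject generic_subobject.
  by apply/is_subobjectP; exact: entails_setT.
have pullE f : hat_names (pullback f generic_subobject) =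
    fun u : arrow_assembly => wedge (r u) (f u).
  by rewrite hat_names_pullback; apply: funext => u; rewrite hat_names_generic.
have pullclE f : hat_names (pullback f (cl j _ generic_subobject)) =
    fun u : arrow_assembly => wedge (r u) (wedge (j (f u)) setT).
  rewrite hat_names_pullback hat_names_cl; apply: funext => u.
  by rewrite /closure_names hat_names_generic.
have sub_pull f : is_subobject (pullback (Y := arrow_assembly) f generic_subobject).
  by apply/is_subobjectP; rewrite pullE; exact: entails_fst.
have srctgt : sub_le (pullback src generic_subobject)
    (pullback tgt generic_subobject).
  apply/sub_leP; rewrite !pullE; apply: entails_wedge; first exact: entails_fst.
  exact: entails_mp (entails_fst _ _) (entails_snd _ _).
(* All maps into [generic_assembly] are computable. Naturality is used in opposite directions: into
   the closure of the pullback along [src], out of the one along [tgt]. *)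
have [_ /sub_leP nsrc] := jnat _ _ src _ (entails_setT _) subG.
have [/sub_leP ntgt _] := jnat _ _ tgt _ (entails_setT _) subG.
have /sub_leP cl_le := jmon _ _ _ (sub_pull src) (sub_pull tgt) srctgt.
have := entails_trans nsrc (entails_trans cl_le ntgt); rewrite !pullclE => H.
have : entails r (fun u => arrow (j (src u)) (j (tgt u))).
  apply: entails_curry.
  apply: (entails_trans _
    (entails_trans (entails_snd r _) (entails_fst _ (fun=> setT)))).
  apply: entails_trans H; apply: entails_wedge; first exact: entails_fst.
  by apply: entails_wedge; [exact: entails_snd | exact: entails_setT].
(* Pairs with p -> q empty are missing from [arrow_assembly], but for them there is no [a] on which
   to test [e]. *)
move=> [e ee eP]; exists e => // p q a pqa.
have pq0 : arrow p q !=set0 by exists a.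
exact: eP (exist _ (p, q) pq0) a pqa.
Qed.

Lemma monotone_cl (j : Omega N -> Omega N) :
  monotone_operation j <-> universal_monotone_operator (cl j).
Proof. by split; [exact: cl_universal | exact: universal_monotone]. Qed.

End Logic.

(** * Primitive recursive closure and Kleene's first algebra *)

Lemma nfst_pair a b : nfst (npair a b) = a.
Proof. by rewrite /nfst /npair Cantor.cancel_of_to. Qed.

Lemma nsnd_pair a b : nsnd (npair a b) = b.
Proof. by rewrite /nsnd /npair Cantor.cancel_of_to. Qed.

Lemma npair_eta n : npair (nfst n) (nsnd n) = n.
Proof. by rewrite /npair /nfst /nsnd -surjective_pairing Cantor.cancel_to_of. Qed.

Lemma leq_npair a b : b <= npair a b.
Proof.
have /leP := Cantor.to_nat_non_decreasing a b.
by rewrite plusE; apply: leq_trans; exact: leq_addr.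
Qed.

Opaque npair nfst nsnd.

Definition npairE := (nfst_pair, nsnd_pair).

(** Keeping [P] abstract lets one construction serve both all functions and the computable ones. In
    [pc_iteri] the arguments of [b], packed by [npair], are parameter, counter and accumulated
    value. *)
Record primrec_closed (P : set (nat -> nat)) : Prop := PrimrecClosed {
  pc_id : P (fun n => n);
  pc_zero : P (fun=> 0);
  pc_succ : forall f, P f -> P (fun n => (f n).+1);
  pc_fst : forall f, P f -> P (fun n => nfst (f n));
  pc_snd : forall f, P f -> P (fun n => nsnd (f n));
  pc_pair : forall f g, P f -> P g -> P (fun n => npair (f n) (g n));
  pc_comp : forall f g, P f -> P g -> P (fun n => f (g n));
  pc_iteri : forall t a b, P t -> P a ->
    P (fun w => b (nfst w) (nfst (nsnd w)) (nsnd (nsnd w))) ->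
    P (fun n => iteri (t n) (b n) (a n)) }.

Lemma primrec_closed_setT : primrec_closed setT.
Proof. by []. Qed.

Lemma goedel_phi c n m : phi (goedel c) n m <-> eval c n m.
Proof. by split=> [[c' /goedel_inj->]|cm] //; exists c. Qed.

Lemma computable_baireP x :
  computable_baire x <-> exists c, forall n, eval c n (x n).
Proof.
split=> [[e ex]|[c cx]]; last by exists (goedel c) => n; exact/goedel_phi.
have [c ce _] := ex 0; exists c => n.
by apply/goedel_phi; rewrite ce.
Qed.

Definition id_code : code := Pair Fst Snd.

Lemma eval_id n : eval id_code n n.
Proof. by exists (nfst n) => //; exists (nsnd n); rewrite // npair_eta. Qed.

Lemma primrec_closed_computable : primrec_closed computable_baire.
Proof.
have comp f g : computable_baire f -> computable_baire g ->
    computable_baire (fun n => f (g n)).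
  move=> /computable_baireP[c cf] /computable_baireP[d dg].
  by apply/computable_baireP; exists (Comp c d) => n; exists (g n).
split=> //.
- by apply/computable_baireP; exists id_code => n; exact: eval_id.
- by apply/computable_baireP; exists Zero.
- by move=> f; apply: comp; apply/computable_baireP; exists Succ.
- by move=> f; apply: comp; apply/computable_baireP; exists Fst.
- by move=> f; apply: comp; apply/computable_baireP; exists Snd.
- move=> f g /computable_baireP[c cf] /computable_baireP[d dg].
  apply/computable_baireP; exists (Pair c d) => n /=.
  by exists (f n) => //; exists (g n).
- move=> t a b /computable_baireP[ct tP] /computable_baireP[ca aP].
  move=> /computable_baireP[cb bP].
  apply/computable_baireP; exists (Comp (Prec ca cb) (Pair id_code ct)) => n.
  exists (npair n (t n)).
    by exists n; [exact: eval_id | exists (t n)].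
  rewrite /= !npairE; elim: (t n) => [|i IHi] /=; first exact: aP.
  exists (iteri i (b n) (a n)) => //.
  by have := bP (npair n (npair i (iteri i (b n) (a n)))); rewrite !npairE.
Qed.

Section Primrec.
Variable P : set (nat -> nat).
Hypothesis HP : primrec_closed P.

Lemma pc_const k : P (fun=> k).
Proof. elim: k => [|k IHk]; [exact: pc_zero | exact: pc_succ]. Qed.

Lemma pc_comp2 f s t : P (fun w => f (nfst w) (nsnd w)) -> P s -> P t ->
  P (fun n => f (s n) (t n)).
Proof.
move=> Pf Ps Pt; have := pc_comp HP Pf (pc_pair HP Ps Pt).
by congr P; apply: funext => n; rewrite !npairE.
Qed.

(** An iteration that ignores its accumulator returns the value of its last pass, whose counter is
    the predecessor. *)
Lemma pc_case t a b : P t -> P a -> P (fun w => b (nfst w) (nsnd w)) ->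
  P (fun n => if t n is k.+1 then b n k else a n).
Proof.
move=> Pt Pa Pb.
have -> : (fun n => if t n is k.+1 then b n k else a n) =
    fun n => iteri (t n) (fun k _ => b n k) (a n).
  by apply: funext => n; case: (t n).
apply: (pc_iteri HP (b := fun n k _ => b n k)) => //.
apply: (pc_comp2 (f := b)) => //; first exact: (pc_fst HP (pc_id HP)).
exact: (pc_fst HP (pc_snd HP (pc_id HP))).
Qed.

End Primrec.

Ltac primrec_ext HP := fail.

Ltac primrec HP := repeat match goal with
  | H : ?P ?f |- ?P ?f => exact H
  | |- _ (fun=> ?k) => exact (pc_const HP k)
  | |- _ (fun n => n) => exact (pc_id HP)
  | |- _ S => exact (pc_succ HP (pc_id HP))
  | |- _ nfst => exact (pc_fst HP (pc_id HP))
  | |- _ nsnd => exact (pc_snd HP (pc_id HP))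
  | |- _ (fun n => (_).+1) => refine (pc_succ HP _)
  | |- _ (fun n => nfst _) => refine (pc_fst HP _)
  | |- _ (fun n => nsnd _) => refine (pc_snd HP _)
  | |- _ (fun n => npair _ _) => refine (pc_pair HP _ _)
  | |- _ (fun n => iteri _ _ _) => refine (pc_iteri HP _ _ _)
  | |- _ (fun n => match _ with 0 => _ | k.+1 => _ end) =>
      refine (pc_case HP _ _ _)
  | H : ?P ?f |- ?P (fun n => ?f _) => refine (pc_comp HP H _)
  | H : ?P (fun w => ?f (nfst w) (nsnd w)) |- ?P (fun n => ?f _ _) =>
      refine (pc_comp2 HP H _ _)
  | _ => primrec_ext HP
  end.

Lemma pc_iter (P : set (nat -> nat)) (HP : primrec_closed P) t f a :
  P t -> P f -> P a -> P (fun n => iter (t n) f (a n)).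
Proof.
move=> Pt Pf Pa.
have -> : (fun n => iter (t n) f (a n)) =
    fun n => iteri (t n) (fun _ r => f r) (a n).
  by apply: funext => n; elim: (t n) => //= k ->.
by primrec HP.
Qed.

(** * A universal function *)

(* States of a stack machine evaluating codes: [ev c n K] is about to compute
   phi_c(n), and [ret m K] passes the result m to the stack [K], which is 0 when
   empty. The frame tags 0 to 4 stand for: first and second component of a
   [Pair], inner function of a [Comp], recursive call of a [Prec], test of a
   [Mu]; the data of a frame are the codes and numbers needed to go on. *)
Definition frame t d K := (npair t (npair d K)).+1.
Definition ret m K := npair 0 (npair m K).
Definition ev c n K := npair 1 (npair (npair c n) K).

Definition ret_step m fr :=
  let d := nfst (nsnd fr) in let K := nsnd (nsnd fr) in
  match nfst fr with
  | 0 => ev (nfst d) (nsnd d) (frame 1 m K)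
  | 1 => ret (npair d m) K
  | 2 => ev d m K
  | 3 => ev (nfst d) (npair (nfst (nsnd d)) (npair (nsnd (nsnd d)) m)) K
  | _ => let n := nfst (nsnd d) in let i := nsnd (nsnd d) in
    if m is _.+1
    then ev (nfst d) (npair n i.+1) (frame 4 (npair (nfst d) (npair n i.+1)) K)
    else ret i K
  end.

Definition ev_step c n K :=
  let d := nsnd c in
  match nfst c with
  | 0 => ret 0 K
  | 1 => ret n.+1 K
  | 2 => ret (nfst n) K
  | 3 => ret (nsnd n) K
  | 4 => ev (nfst d) n (frame 0 (npair (nsnd d) n) K)
  | 5 => ev (nsnd d) n (frame 2 (nfst d) K)
  | 6 => if nsnd n is i.+1
    then ev c (npair (nfst n) i) (frame 3 (npair (nsnd d) (npair (nfst n) i)) K)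
    else ev (nfst d) (nfst n) K
  | _ => ev d (npair n 0) (frame 4 (npair d (npair n 0)) K)
  end.

Definition step s :=
  let x := nfst (nsnd s) in let K := nsnd (nsnd s) in
  if nfst s is _.+1 then ev_step (nfst x) (nsnd x) K
  else if K is fr.+1 then ret_step x fr else s.

Lemma pc_step (P : set (nat -> nat)) : primrec_closed P -> P step.
Proof.
move=> HP; rewrite /step /ev_step /ret_step /frame /ret /ev /=.
by primrec HP.
Qed.

Lemma step_ev c n K : step (ev c n K) = ev_step c n K.
Proof. by rewrite /step /ev !npairE. Qed.

Lemma step_ret m t d K : step (ret m (frame t d K)) =
  ret_step m (npair t (npair d K)).
Proof. by rewrite /step /ret /frame !npairE. Qed.

Lemma step_ret0 m : step (ret m 0) = ret m 0.
Proof. by rewrite /step /ret !npairE. Qed.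

Definition reaches s s' := exists k, iter k step s = s'.

Lemma reaches_step s s' : reaches (step s) s' -> reaches s s'.
Proof. by move=> [k ks]; exists k.+1; rewrite iterSr. Qed.

Lemma reaches_trans s' s s'' : reaches s s' -> reaches s' s'' -> reaches s s''.
Proof. by move=> [k <-] [l <-]; exists (l + k); rewrite iterD. Qed.

(** The stack [K] is arbitrary so that the induction hypotheses apply to subcomputations run under
    additional frames. *)
Lemma eval_reaches c n m K : eval c n m -> reaches (ev (goedel c) n K) (ret m K).
Proof.
elim: c n m K => [||||f IHf g IHg|f IHf g IHg|f IHf g IHg|f IHf] n m K.
- by move=> ->; exists 1; rewrite /= step_ev /ev_step /= !npairE.
- by move=> ->; exists 1; rewrite /= step_ev /ev_step /= !npairE.
- by move=> ->; exists 1; rewrite /= step_ev /ev_step /= !npairE.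
- by move=> ->; exists 1; rewrite /= step_ev /ev_step /= !npairE.
- move=> /= [a fa [b gb <-]]; apply: reaches_step; rewrite step_ev /ev_step !npairE.
  apply: reaches_trans (IHf _ _ _ fa) _.
  apply: reaches_step; rewrite step_ret /ret_step !npairE.
  apply: reaches_trans (IHg _ _ _ gb) _.
  by exists 1; rewrite /= step_ret /ret_step !npairE.
- move=> /= [k gk fk]; apply: reaches_step; rewrite step_ev /ev_step !npairE.
  apply: reaches_trans (IHg _ _ _ gk) _.
  by apply: reaches_step; rewrite step_ret /ret_step !npairE; exact: IHf.
- rewrite -{2}(npair_eta n) [eval _ _]/=; move: (nfst n) (nsnd n) => a i {n}.
  elim: i m K => [|i IHi] m K; rewrite /=.
    by move=> fm; apply: reaches_step; rewrite step_ev /ev_step !npairE; exact: IHf.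
  move=> [k hk gk]; apply: reaches_step; rewrite step_ev /ev_step !npairE.
  apply: reaches_trans (IHi _ _ hk) _.
  by apply: reaches_step; rewrite step_ret /ret_step !npairE; exact: IHg.
- move=> /= [f0 fS].
  suff loop i : i <= m -> reaches
      (ev (goedel f) (npair n i) (frame 4 (npair (goedel f) (npair n i)) K))
      (ret m K).
    by apply: reaches_step; rewrite step_ev /ev_step !npairE; exact: loop.
  (* Induction on the number [m - i] of tests still to fail. *)
  move=> /subnK; move: (m - i) => d; elim: d i => [|d IHd] i.
    rewrite add0n => ->; apply: reaches_trans (IHf _ _ _ f0) _.
    by exists 1; rewrite /= step_ret /ret_step !npairE.
  move=> im; have [|k fk] := fS i; first by rewrite -im addSn ltnS leq_addl.
  apply: reaches_trans (IHf _ _ _ fk) _.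
  apply: reaches_step; rewrite step_ret /ret_step !npairE.
  by apply: IHd; rewrite addnS.
Qed.

(** Stopped states get the value 0 because [Mu] searches for a zero. *)
Definition unfinished s :=
  if nfst s is _.+1 then 1 else if nsnd (nsnd s) is _.+1 then 1 else 0.

Lemma unfinished0 s : unfinished s = 0 -> s = ret (nfst (nsnd s)) 0.
Proof.
have {2}-> : s = npair (nfst s) (npair (nfst (nsnd s)) (nsnd (nsnd s))).
  by rewrite !npair_eta.
rewrite /unfinished; case: (nfst s) => //.
by case: (nsnd (nsnd s)).
Qed.

(** Kleene's normal form: minimize the number of machine steps, then read off the result. *)
Lemma universal_code : exists u, forall c n m,
  eval c n m -> eval u (npair (goedel c) n) m.
Proof.
have HP := primrec_closed_computable.
pose run w := iter (nsnd w) step (ev (nfst (nfst w)) (nsnd (nfst w)) 0).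
have run_comp : computable_baire run.
  apply: (pc_iter HP) (pc_step HP) _; first by primrec HP.
  by rewrite /ev; primrec HP.
have /computable_baireP[ct ctP] : computable_baire (fun w => unfinished (run w)).
  by rewrite /unfinished; primrec HP.
have /computable_baireP[co coP] : computable_baire (fun w => nfst (nsnd (run w))).
  by primrec HP.
(* Stopped states are fixed by [step], so the least stopping time found by [Mu]
   yields the same value as the one given by [eval_reaches]. *)
exists (Comp co (Pair id_code (Mu ct))) => c n m cnm; set w := npair _ n.
have [k kP] := eval_reaches 0 cnm.
have stop : exists i, unfinished (run (npair w i)) == 0.
  by exists k; rewrite /run !npairE kP /unfinished /ret !npairE.
case: (ex_minnP stop) => i /eqP i0 imin.
exists (npair w i).
  exists w; first exact: eval_id.
  exists i => //; split; first by have := ctP (npair w i); rewrite i0.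
  move=> i' i'i; have := ctP (npair w i'); case E: (unfinished _) => [|r].
    by have := imin i'; rewrite E leqNgt i'i => /(_ isT).
  by exists r.
have := coP (npair w i); congr (eval _ _ _); have := unfinished0 i0.
set x := nfst _; rewrite /run !npairE => xP.
have fixed y l : iter l step (ret y 0) = ret y 0.
  by elim: l => //= l ->; exact: step_ret0.
have ret_inj y y' : ret y 0 = ret y' 0 -> y = y'.
  by move=> /npair_inj[_ /npair_inj[]].
apply: ret_inj; case: (leqP i k) => [/subnK ik|/ltnW/subnK ki].
  by rewrite -kP -ik iterD xP fixed.
by rewrite -xP -ki iterD kP fixed.
Qed.

Definition const_code k := iter k (Comp Succ) Zero.

Lemma eval_const k n : eval (const_code k) n k.
Proof. by elim: k => [|k IHk] //=; exists k. Qed.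

Lemma combinatory_kleene_first : combinatory kleene_first.
Proof.
have [u uP] := universal_code.
split.
- exists (goedel Fst) => // a b; apply/goedel_phi; exact/esym/nfst_pair.
- exists (goedel Snd) => // a b; apply/goedel_phi; exact/esym/nsnd_pair.
- move=> k _; exists (goedel (const_code k)) => // a.
  apply/goedel_phi; exact: eval_const.
- move=> f g _ _.
  (* A number that is no Goedel number indexes the empty function; the requirement is then vacuous
     and 0 will do. *)
  have [[c cf]|nf] := pselect (exists c, goedel c = f); last first.
    by exists 0 => // a b c [d df]; case: nf; exists d.
  have [[d dg]|ng] := pselect (exists c, goedel c = g); last first.
    by exists 0 => // a b e _ [d dg]; case: ng; exists d.
  exists (goedel (Pair c d)) => // a b e.
  rewrite -cf -dg => /goedel_phi cb /goedel_phi de; apply/goedel_phi.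
  by exists b => //; exists e.
- move=> f g _ _.
  have [[c cf]|nf] := pselect (exists c, goedel c = f); last first.
    by exists 0 => // a b c e [d df]; case: nf; exists d.
  have [[d dg]|ng] := pselect (exists c, goedel c = g); last first.
    by exists 0 => // a b e e' _ [d dg]; case: ng; exists d.
  exists (goedel (Comp u (Pair c d))) => // a b e e'.
  rewrite -cf -dg => /goedel_phi cb /goedel_phi de [r rb rP]; apply/goedel_phi.
  exists (npair b e); last by rewrite -rb; exact: uP.
  by exists b => //; exists e.
- move=> f _.
  (* The s-m-n function, with the tags of [Comp] and [Pair]. It uses the number [f] itself, so it is
     total even if [f] is no Goedel number. *)
  pose smn a := npair 5 (npair f (npair 4
    (npair (goedel (const_code a)) (goedel id_code)))).
  have /computable_baireP[s sP] : computable_baire smn.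
    have HP := primrec_closed_computable.
    have -> : smn = fun a => npair 5 (npair f (npair 4 (npair
        (iteri a (fun _ r => npair 5 (npair (goedel Succ) r)) (goedel Zero))
        (goedel id_code)))).
      apply: funext => a; rewrite /smn.
      suff -> : goedel (const_code a) =
        iteri a (fun _ r => npair 5 (npair (goedel Succ) r)) (goedel Zero) by [].
      by elim: a => //= a ->.
    by primrec HP.
  exists (goedel s) => // a; exists (smn a); first by apply/goedel_phi; exact: sP.
  move=> b c [r rf rP]; rewrite /smn -rf.
  exists (Comp r (Pair (const_code a) id_code)) => //.
  exists (npair a b) => //; exists a; first exact: eval_const.
  by exists b => //; exact: eval_id.
Qed.

(** * Associates on Baire space *)

Definition prefix (f : baire) k := tuple_code (mkseq f k).
Definition tail s := if s is v.+1 then nsnd v else 0.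
(* [look s i] is 0 beyond the end of the sequence coded by [s], and the
   [i]-th entry plus 1 before it. *)
Definition look s i := if iter i tail s is v.+1 then (nfst v).+1 else 0.
Definition entry s i := if look s i is v.+1 then v else 0.
Definition len s := iteri s (fun i r => if look s i is _.+1 then r.+1 else r) 0.
Definition first_nz (h : nat -> nat) m :=
  iteri m.+1 (fun k r => if r is _.+1 then r else h k) 0.
(** Bounded simulation of x * f at [n]: the answer plus 1 if a prefix of length at most [m] yields
    one, else 0. *)
Definition search (x : baire) n (f : baire) m :=
  first_nz (fun k => x (npair n (prefix f k)).+1) m.
(** A nonempty coded sequence is n followed by a prefix of the argument; [Phi] receives n and the
    code of that prefix. *)
Definition associate (Phi : nat -> nat -> nat) : baire :=
  fun c => if c is w.+1 then Phi (nfst w) (nsnd w) else 0.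

Lemma look_code s i : look (tuple_code s) i =
  if i < size s then (nth 0 s i).+1 else 0.
Proof.
rewrite /look; elim: s i => [|a s IHs] [|i] //=.
- by rewrite -iterS iterSr /=; elim: i => //= i; case: (iter _ _ _).
- by rewrite nfst_pair.
- by rewrite -iterS iterSr /= nsnd_pair IHs.
Qed.

Lemma size_tuple_code s : size s <= tuple_code s.
Proof. by elim: s => //= a s IHs; rewrite ltnS (leq_trans IHs)// leq_npair. Qed.

Lemma len_code s : len (tuple_code s) = size s.
Proof.
rewrite /len -[RHS](minn_idPr (size_tuple_code s)).
elim: {1 3}(tuple_code s) => [|k IHk] /=; first by rewrite min0n.
rewrite IHk look_code; case: (ltnP k (size s)) => ks.
  by rewrite (minn_idPl ks).
by rewrite (minn_idPr (leqW ks)).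
Qed.

Lemma len_prefix f m : len (prefix f m) = m.
Proof. by rewrite len_code size_mkseq. Qed.

Lemma look_prefix f m i : look (prefix f m) i = if i < m then (f i).+1 else 0.
Proof. by rewrite look_code size_mkseq; case: ifP => // im; rewrite nth_mkseq. Qed.

Lemma entry_prefix f m i : i < m -> entry (prefix f m) i = f i.
Proof. by rewrite /entry look_prefix => ->. Qed.

Lemma eq_prefix f g k : (forall i, i < k -> f i = g i) -> prefix f k = prefix g k.
Proof.
move=> fg; congr tuple_code; apply/eq_in_map => i.
by rewrite mem_iota => /andP[_]; exact: fg.
Qed.

Lemma first_nzS h m :
  first_nz h m.+1 = if first_nz h m is v.+1 then v.+1 else h m.+1.
Proof. by rewrite /first_nz iteriS; case: (iteri m.+1 _ _). Qed.

Lemma eq_first_nz h h' m : (forall k, k <= m -> h k = h' k) ->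
  first_nz h m = first_nz h' m.
Proof.
elim: m => [|m IHm] hh'; first by rewrite /first_nz /= hh'.
by rewrite !first_nzS IHm ?hh'// => k km; exact/hh'/leqW.
Qed.

Lemma first_nz_miss h m : (forall k, k <= m -> h k = 0) -> first_nz h m = 0.
Proof.
move=> /(@eq_first_nz h (fun=> 0)) ->.
by elim: m => // m IHm; rewrite first_nzS IHm.
Qed.

Lemma first_nz_hit h m k : k <= m -> h k <> 0 ->
  (forall i, i < k -> h i = 0) -> first_nz h m = h k.
Proof.
move=> km hk h0; rewrite -(subnK km); elim: (m - k) => [|d IHd]; last first.
  by rewrite addSn first_nzS IHd; case: (h k) hk.
by case: k hk h0 {km} => [|k] hk h0 //; rewrite add0n first_nzS first_nz_miss.
Qed.

Lemma eq_search x n f g m : (forall i, i < m -> f i = g i) ->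
  search x n f m = search x n g m.
Proof.
move=> fg; apply: eq_first_nz => k km.
by rewrite (@eq_prefix f g)// => i ik; apply: fg; exact: leq_trans ik km.
Qed.

Lemma search_threshold x y z n : bapp x y z ->
  exists K, forall m, search x n y m = if K <= m then (z n).+1 else 0.
Proof.
move=> /(_ n)[K xK x0]; exists K => m; case: ifP => [Km|/negbT].
  by rewrite /search (first_nz_hit (k := K)) ?xK.
rewrite -ltnNge => mK; apply: first_nz_miss => k km.
by apply: x0; exact: leq_ltn_trans mK.
Qed.

(** Application reads the shortest prefix with a nonzero value, and by soundness that value is the
    right one. *)
Lemma bapp_associate Phi y z :
  (forall n m, Phi n (prefix y m) = 0 \/ Phi n (prefix y m) = (z n).+1) ->
  (forall n, exists m, Phi n (prefix y m) <> 0) ->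
  bapp (associate Phi) y z.
Proof.
move=> sound total n.
have nz : exists m, Phi n (prefix y m) != 0.
  by have [m /eqP] := total n; exists m.
case: (ex_minnP nz) => k Phik kmin; exists k.
  rewrite /= !npairE; have [Phi0|PhiS] := sound n k; last exact: PhiS.
  by rewrite Phi0 in Phik.
move=> i ik; rewrite /= !npairE; apply/eqP; apply: contraLR ik => Phii.
by rewrite -leqNgt; exact: kmin.
Qed.

Section PrimrecBaire.
Variable P : set (nat -> nat).
Hypothesis HP : primrec_closed P.

Lemma pc_sub s t : P s -> P t -> P (fun n => s n - t n).
Proof.
move=> Ps Pt.
have -> : (fun n => s n - t n) = fun n => iter (t n) predn (s n).
  apply: funext => n; elim: (t n) => [|k IHk] /=; first exact: subn0.
  by rewrite subnS IHk.
apply: (pc_iter HP) => //.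
have -> : predn = fun n => if n is k.+1 then k else 0 by apply: funext => -[].
by primrec HP.
Qed.

Lemma pc_look s t : P s -> P t -> P (fun n => look (s n) (t n)).
Proof.
move=> Ps Pt; rewrite /look.
have Pi : P (fun n => iter (t n) tail (s n)).
  by apply: (pc_iter HP) => //; rewrite /tail; primrec HP.
by primrec HP.
Qed.

Lemma pc_prefix f k : P (fun w => f (nfst w) (nsnd w)) -> P k ->
  P (fun n => prefix (f n) (k n)).
Proof.
move=> Pf Pk.
(* A code is built from its last entry, so pass i prepends the entry of index [k n - i.+1]. *)
have -> : (fun n => prefix (f n) (k n)) =
    fun n => iteri (k n) (fun i r => (npair (f n (k n - i.+1)) r).+1) 0.
  apply: funext => n; move: (k n) => l.
  suff H i : i <= l -> iteri i (fun i r => (npair (f n (l - i.+1)) r).+1) 0 =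
      tuple_code (map (f n) (iota (l - i) i)).
    by rewrite H// subnn.
  elim: i => //= i IHi il; rewrite IHi ?(ltnW il)//.
  by rewrite subnSK.
have Pfk : P (fun w => f (nfst w) (k (nfst w) - (nfst (nsnd w)).+1)).
  apply: (pc_comp2 HP Pf); first by primrec HP.
  by apply: pc_sub; primrec HP.
by primrec HP.
Qed.

Lemma pc_entry s t : P s -> P t -> P (fun n => entry (s n) (t n)).
Proof. by move=> Ps Pt; have Pl := pc_look Ps Pt; rewrite /entry; primrec HP. Qed.

Lemma pc_len s : P s -> P (fun n => len (s n)).
Proof.
move=> Ps; rewrite /len.
have Pl : P (fun w => look (s (nfst w)) (nfst (nsnd w))).
  by apply: pc_look; primrec HP.
by primrec HP.
Qed.

Lemma pc_first_nz h m : P (fun w => h (nfst w) (nsnd w)) -> P m ->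
  P (fun n => first_nz (h n) (m n)).
Proof. by move=> Ph Pm; rewrite /first_nz; primrec HP. Qed.

Lemma pc_search x n f m : P x -> P n -> P (fun w => f (nfst w) (nsnd w)) ->
  P m -> P (fun w => search x (n w) (f w) (m w)).
Proof.
move=> Px Pn Pf Pm; apply: pc_first_nz => //.
have Pp : P (fun w => prefix (f (nfst w)) (nsnd w)).
  apply: (pc_prefix (f := fun w => f (nfst w))); last by primrec HP.
  by primrec HP.
by primrec HP.
Qed.

Lemma pc_associate Phi : P (fun w => Phi (nfst w) (nsnd w)) -> P (associate Phi).
Proof. by move=> PPhi; rewrite /associate; primrec HP. Qed.

Lemma pc_odd t a b : P t -> P a -> P b ->
  P (fun n => if odd (t n) then a n else b n).
Proof.
move=> Pt Pa Pb.
have -> : (fun n => if odd (t n) then a n else b n) = fun n =>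
    if iteri (t n) (fun _ r => if r is _.+1 then 0 else 1) 0 is _.+1
    then a n else b n.
  apply: funext => n.
  suff -> : iteri (t n) (fun _ r => if r is _.+1 then 0 else 1) 0 = odd (t n).
    by case: (odd (t n)).
  by elim: (t n) => //= k ->; case: (odd k).
by primrec HP.
Qed.

Lemma pc_half t : P t -> P (fun n => (t n)./2).
Proof.
move=> Pt.
(* Half of t is the number of odd numbers below t. *)
have -> : (fun n => (t n)./2) =
    fun n => iteri (t n) (fun k r => if odd k then r.+1 else r) 0.
  apply: funext => n; elim: (t n) => //= k <-.
  by rewrite uphalf_half; case: (odd k).
have Pb : P (fun w => if odd (nfst (nsnd w)) then (nsnd (nsnd w)).+1
    else nsnd (nsnd w)) by apply: pc_odd; primrec HP.
exact: (pc_iteri HP (b := fun _ k r => if odd k then r.+1 else r) Pt (pc_zero HP)).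
Qed.

Lemma pc_double t : P t -> P (fun n => (t n).*2).
Proof.
move=> Pt.
have -> : (fun n => (t n).*2) = fun n => iteri (t n) (fun _ r => r.+2) 0.
  by apply: funext => n; elim: (t n) => //= k <-.
by primrec HP.
Qed.

End PrimrecBaire.

Ltac primrec_ext HP ::= match goal with
  | |- _ (fun n => _ - _) => refine (pc_sub HP _ _)
  | |- _ (fun n => look _ _) => refine (pc_look HP _ _)
  | |- _ (fun n => entry _ _) => refine (pc_entry HP _ _)
  | |- _ (fun n => len _) => refine (pc_len HP _)
  | |- _ (fun n => prefix _ _) => refine (pc_prefix HP _ _)
  | |- _ (fun n => first_nz _ _) => refine (pc_first_nz HP _ _)
  | |- _ (fun n => search _ _ _ _) => refine (pc_search HP _ _ _ _)
  | |- _ (associate _) => refine (pc_associate HP _)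
  | |- _ (fun n => if odd _ then _ else _) => refine (pc_odd HP _ _ _)
  | |- _ (fun n => _./2) => refine (pc_half HP _)
  | |- _ (fun n => _.*2) => refine (pc_double HP _)
  end.

(* Prefixes of [bpair u z] of length at most [len s] only involve the part of z
   coded by [s], as i./2 <= i. *)
Definition curried (x u : baire) : baire := associate (fun n s =>
  search x n (bpair u (entry s)) (len s)).

Lemma bapp_curried x u z w : bapp x (bpair u z) w -> bapp (curried x u) z w.
Proof.
move=> xw; have E n m : search x n (bpair u (entry (prefix z m))) m =
    search x n (bpair u z) m.
  apply: eq_search => i im; rewrite /bpair entry_prefix//.
  by rewrite (leq_ltn_trans _ im)// leq_half_double -addnn leqW// leq_addr.
apply: bapp_associate => n => [m|]; have [K KP] := search_threshold n xw.
  by rewrite len_prefix E KP; case: ifP; [right|left].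
by exists K; rewrite len_prefix E KP leqnn.
Qed.

(** * The associate of the map sending a to (x * a) * (y * a) *)

Section Application.
Variables x y : baire.

(** A 0/1 test whether [s] determines the first [k] values of y * a; [query] consults
    [query_answer], which defaults to 0, only if it gives 1. *)
Definition query_defined s k := iteri k
  (fun i r => if search y i (entry s) (len s) is _.+1 then r else 0) 1.

Definition query_answer s i :=
  if search y i (entry s) (len s) is v.+1 then v else 0.

(* In the computation of (x * a) * (y * a) from a finite part [s] of a, [query]
   is the outcome of the [k]-th question to x * a: 0 if it answers 0, v + 2 if it
   answers v + 1, and 1 if [s] does not determine the answer, so that the search
   stops there. *)
Definition query n s k :=
  if query_defined s k is _.+1 then
    if search x (npair n (prefix (query_answer s) k)).+1 (entry s) (len s) is v.+1
    then if v is _.+1 then v.+1 else 0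
    else 1
  else 1.

(** Dropping 1 from the outcome turns an undetermined query into no answer yet, and v + 2 into the
    answer v + 1. *)
Definition app_approx n s :=
  if first_nz (query n s) (len s) is v.+1 then v else 0.

Section Correctness.
Variables a b c d : baire.
Hypotheses (xab : bapp x a b) (yac : bapp y a c) (bcd : bapp b c d).

Let ideal n k := if b (npair n (prefix c k)).+1 is v.+1 then v.+2 else 0.

Lemma search_prefix e n m :
  search e n (entry (prefix a m)) (len (prefix a m)) = search e n a m.
Proof. by rewrite len_prefix; apply: eq_search => i; exact: entry_prefix. Qed.

Lemma query_definedP m k :
  (forall i, i < k -> search y i a m <> 0) \/
  query_defined (prefix a m) k = 0.
Proof.
elim: k => [|k [IHk|IHk]]; first by left.
- case E: (search y k a m) => [|v].
    by right; rewrite /query_defined iteriS search_prefix E.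
  left=> i; rewrite ltnS leq_eqVlt => /predU1P[->|]; last exact: IHk.
  by rewrite E.
- right; rewrite /query_defined iteriS -/(query_defined _ _) IHk.
  by case: search.
Qed.

Lemma query_answerE m i : search y i a m <> 0 -> query_answer (prefix a m) i = c i.
Proof.
have [K KP] := search_threshold i yac.
by rewrite /query_answer search_prefix KP; case: ifP.
Qed.

Lemma query_sound n m k :
  query n (prefix a m) k = 1 \/ query n (prefix a m) k = ideal n k.
Proof.
rewrite /query; case D: (query_defined _ k) => [|r]; first by left.
have [def|] := query_definedP m k; last by rewrite D.
rewrite (@eq_prefix _ c) => [|i ik]; last exact/query_answerE/def.
have [K KP] := search_threshold (npair n (prefix c k)).+1 xab.
rewrite search_prefix KP; case: ifP => _; [right|by left].
by rewrite /ideal; case: (b _).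
Qed.

(** The query depends on [k] values of [c] and one value of [b]; beyond the largest of their
    thresholds it is settled. *)
Lemma query_total n k : exists M, forall m, M <= m ->
  query n (prefix a m) k = ideal n k.
Proof.
have [M MP] : exists M, forall m, M <= m ->
    query_defined (prefix a m) k = 1 /\ forall i, i < k -> search y i a m <> 0.
  elim: k => [|k [M MP]]; first by exists 0.
  have [K KP] := search_threshold k yac; exists (maxn M K) => m.
  rewrite geq_max => /andP[/MP[D S] Km]; split.
    by rewrite /query_defined iteriS -/(query_defined _ _) D search_prefix KP Km.
  move=> i; rewrite ltnS leq_eqVlt => /predU1P[->|]; last exact: S.
  by rewrite KP Km.
have [K KP] := search_threshold (npair n (prefix c k)).+1 xab.
exists (maxn M K) => m; rewrite geq_max => /andP[/MP[D S] Km].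
rewrite /query D (@eq_prefix _ c) => [|i ik]; last exact/query_answerE/S.
by rewrite search_prefix KP Km /ideal; case: (b _).
Qed.

Lemma bapp_app_approx : bapp (associate app_approx) a d.
Proof.
have idealP n : exists2 k, ideal n k = (d n).+2 & forall i, i < k -> ideal n i = 0.
  have [k bk b0] := bcd n; exists k; first by rewrite /ideal [b _]bk.
  by move=> i ik; rewrite /ideal [b _]b0.
apply: bapp_associate => n => [m|]; have [k ik i0] := idealP n.
- rewrite /app_approx len_prefix.
  have [/existsP[i qi]|none] :=
    boolP [exists i : 'I_m.+1, query n (prefix a m) i != 0].
    have nz : exists l, (l <= m) && (query n (prefix a m) l != 0).
      by exists i; rewrite qi andbT -ltnS ltn_ord.
    case: (ex_minnP nz) => l /andP[lm /eqP ql] lmin.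
    have below l' : l' < l -> query n (prefix a m) l' = 0.
      move=> l'l; apply/eqP; apply: contraLR l'l => ql'.
      rewrite -leqNgt; have [l'm|/ltnW] := leqP l' m; last exact: leq_trans.
      by apply: lmin; rewrite l'm.
    (* [l] is the first nonzero actual outcome, [k] the first nonzero ideal one. An outcome 0 is
       never undetermined, so [l] cannot exceed [k]; if the outcome at [l] is determined, it is
       ideal, whence [l = k]. *)
    rewrite (first_nz_hit lm ql below); have [kl|lk] := ltnP k l.
      by have [] := query_sound n m k; rewrite below// ik.
    have [->|q] := query_sound n m l; first by left.
    right; rewrite q; move: lk; rewrite leq_eqVlt => /predU1P[->|/i0 il].
      by rewrite ik.
    by rewrite q il in ql.
  left; rewrite first_nz_miss// => i im; apply/eqP; apply: contraNT none => qi.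
  by apply/existsP; exists (Ordinal (im : i < m.+1)).
- have [M MP] : exists M, forall m, M <= m -> forall l, l <= k ->
      query n (prefix a m) l = ideal n l.
    elim: k {ik i0} => [|k [M MP]].
      have [M MP] := query_total n 0.
      by exists M => m /MP q [].
    have [K KP] := query_total n k.+1; exists (maxn M K) => m.
    rewrite geq_max => /andP[Mm Km] l.
    by rewrite leq_eqVlt => /predU1P[->|]; [exact: KP|exact: MP].
  (* The prefix must settle all queries up to [k], and its length also bounds the search, which has
     to reach [k]. *)
  exists (maxn M k); rewrite /app_approx len_prefix.
  have q := MP _ (leq_maxl M k).
  have qk : query n (prefix a (maxn M k)) k = (d n).+2 by rewrite q.
  rewrite (first_nz_hit (leq_maxr M k)) ?qk// => i ik'.
  by rewrite q ?i0// ltnW.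
Qed.

End Correctness.
End Application.

Section Laws.
Variable P : set baire.
Hypothesis HP : primrec_closed P.

Lemma combinatory_baire : combinatory (@Algebra baire P bapp bapp_fun bpair).
Proof.
split; rewrite /=.
- exists (associate (fun n s => look s n.*2)); first by primrec HP.
  move=> a b; apply: bapp_associate => n => [m|].
    rewrite look_prefix /bpair odd_double doubleK.
    by case: ifP; [right|left].
  by exists n.*2.+1; rewrite look_prefix ltnSn.
- exists (associate (fun n s => look s n.*2.+1)); first by primrec HP.
  move=> a b; apply: bapp_associate => n => [m|].
    rewrite look_prefix /bpair /= odd_double uphalf_double.
    by case: ifP; [right|left].
  by exists n.*2.+2; rewrite look_prefix ltnSn.
- move=> c Pc; exists (associate (fun n _ => (c n).+1)); first by primrec HP.
  move=> a; apply: bapp_associate => n => [m|]; first by right.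
  by exists 0.
- move=> x y Px Py; exists (associate (fun n s =>
    if odd n then y (npair n./2 s).+1 else x (npair n./2 s).+1)).
    by primrec HP.
  move=> a b c xab yac n; rewrite /bpair.
  have [k xk x0] := xab n./2; have [l yl y0] := yac n./2.
  case: (boolP (odd n)) => no; [exists l | exists k] => [|i ik||i ik];
    rewrite /= !npairE ?no ?(negbTE no).
  + exact: yl.
  + exact: y0.
  + exact: xk.
  + exact: x0.
- move=> x y Px Py; exists (associate (app_approx x y)).
    by rewrite /app_approx /query /query_defined /query_answer; primrec HP.
  by move=> a b c d; exact: bapp_app_approx.
(* [nsnd w] codes a prefix of the second argument; the value of [curried x u] there is known once
   [s], a prefix of u, is as long. Outputs are shifted by 1; an associate is 0 at index 0, whence
   the last 1. *)
- move=> x Px; exists (associate (fun n s => if n is w.+1 then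
      if len (nsnd w) - len s is _.+1 then 0
      else (search x (nfst w) (bpair (entry s) (entry (nsnd w))) (len (nsnd w))).+1
    else 1)).
    by rewrite /bpair; primrec HP.
  move=> u; exists (curried x u); last by move=> b c; exact: bapp_curried.
  apply: bapp_associate => -[|w]; rewrite /curried /associate.
  + by right.
  + move=> m; rewrite len_prefix.
    case E: (_ - _) => [|r]; [right|by left].
    congr _.+1; apply: eq_search => i iw; rewrite /bpair; case: ifP => // _.
    rewrite entry_prefix//.
    have i2 : i./2 < len (nsnd w).
      by rewrite (leq_ltn_trans _ iw)// leq_half_double -addnn leqW// leq_addr.
    by apply: leq_trans i2 _; rewrite -subn_eq0 E.
  + by exists 0.
  + by exists (len (nsnd w)); rewrite len_prefix subnn.
Qed.
End Laws.

Theorem proposition4p21 (N : algebra)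
    (hN : [\/ N = kleene_first, N = kleene_second | N = kleene_vesley])
    (j : Omega N -> Omega N) :
  monotone_operation j <-> universal_monotone_operator (cl j).
Proof.
apply: monotone_cl; case: hN => ->.
- exact: combinatory_kleene_first.
- exact: combinatory_baire primrec_closed_setT.
- exact: combinatory_baire primrec_closed_computable.
Qed.
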